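(* Let $n \ge m \ge 1$ be integers and let $\mathcal{U}$ be a box uncertainty set $$\mathcal{U}=\left\{d\in\mathbb{R}^n:\ d_i\in[\underline{d}_i,\bar d_i],\ i\in[n]\right\},\qquad 0\le \underline{d}_i\le \bar d_i<\infty .$$ Then the optimal static allocation (SA) policy, the optimal static list (SL) policy, and the optimal adaptive robust (AR) policy for scheduling $n$ tasks on $m$ identical machines with task durations in $\mathcal{U}$ have the same worst-case makespan, i.e. $$\min_{J\in\mathcal{J}_{n,m}}\ \sup_{d\in\mathcal{U}}\ \max_{j\in[m]}\sum_{i\in J_j}d_i\;=\;\min_{\pi\in\Pi_n}\ \sup_{d\in\mathcal{U},\,J=\mathcal{M}(P^{\mathrm{SL},\pi},d)}\ \max_{j\in[m]}\sum_{i\in J_j}d_i\;=\;\min_{P\in\mathcal{P}}\ \sup_{d\in\mathcal{U},\,J=\mathcal{M}(P,d)}\ \max_{j\in[m]}\sum_{i\in J_j}d_i .$$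
   Context: Notation: $[n]=\{1,\dots,n\}$. There are $n$ tasks and $m$ identical machines, all available at time $0$; there are no precedence relations and no preemption. The vector of task durations $d=(d_1,\dots,d_n)$ is unknown to the scheduler in advance; it is only known to lie in the uncertainty set $\mathcal{U}$ of nonnegative vectors. The duration of a task is revealed when the task completes; while a task is running, the scheduler only knows that its duration is at least its elapsed processing time. States and policies. Whenever a machine is idle and an unstarted task exists, a task must immediately be started on the idle machine. The system state at such a moment is $(S,F,D,I,\bar D)$, where $S$ is the ordered list of started tasks (in order of starting), $F$ is the ordered list of completed tasks (in order of completion), $D$ is the list of realized durations of the tasks in $F$, $I$ is the set of tasks currently being processed, and $\bar D$ is the vector of their elapsed processing times. Ties are broken arbitrarily (by a fixed rule). A policy $P$ is a map assigning to each state the next task to start, $P(S,F,D,I,\bar D)\in[n]\setminus S$. $\mathcal{P}$ is the set of all policies. The optimal AR policy is a policy minimizing the worst-case makespan over $\mathcal{P}$. Schedule generated by a policy. For a policy $P$ and duration vector $d$, running $P$ when the true durations are $d$ (each newly selected task being started on the machine that becomes idle earliest) produces an assignment of tasks to machines; $\mathcal{M}(P,d)=(J_1,\dots,J_m)$ denotes the resulting (ordered) partition of $[n]$ into the sets of tasks processed by machines $1,\dots,m$. Its makespan is $\max_{j\in[m]}\sum_{i\in J_j}d_i$. SA policies. $\mathcal{J}_{n,m}$ is the set of all partitions $J=(J_1,\dots,J_m)$ of $[n]$ into $m$ pairwise disjoint (possibly empty) sets with union $[n]$. The SA policy associated with $J$ processes the tasks in $J_j$ on machine $j$ regardless of the observed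 durations; its makespan under $d$ is $\max_{j\in[m]}\sum_{i\in J_j}d_i$. SL policies. $\Pi_n$ is the set of all permutations $\pi=(\pi_1,\dots,\pi_n)$ of $[n]$. The SL policy $P^{\mathrm{SL},\pi}\in\mathcal{P}$ always starts the first not-yet-started task of the list $\pi$ on the idle machine: $P^{\mathrm{SL},\pi}(S,F,D,I,\bar D)=\pi_i$ with $i=\min\{k\in[n]:\pi_k\notin S\}$. *)

(* Defs.v *)
From HB Require Import structures.
From mathcomp Require Import all_boot all_order all_algebra perm.
From mathcomp Require Import boolp classical_sets reals constructive_ereal ereal.

Set Implicit Arguments.
Unset Strict Implicit.
Unset Printing Implicit Defensive.

Import Order.TTheory GRing.Theory Num.Theory.
Local Open Scope ring_scope.

Definition allocation (n m : nat) := {ffun 'I_m -> {set 'I_n}}.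

Definition is_partition n m (J : allocation n m) : Prop :=
  (forall j k, j != k -> [disjoint J j & J k]) /\
  (\bigcup_(j < m) J j)%SET = [set: 'I_n]%SET.

Definition load (R : realType) n m (d : 'rV[R]_n) (J : allocation n m)
  (j : 'I_m) : R := \sum_(i in J j) d 0 i.

(* Durations are nonnegative, so the default value 0 does not affect the
   maximum. *)
Definition makespan (R : realType) n m (d : 'rV[R]_n) (J : allocation n m) : R :=
  \big[Num.max/0]_(j < m) load d J j.

(* [elapsed] is the vector of elapsed processing times of the tasks in
   [running], padded with 0 outside [running]. *)
Record state (R : realType) (n : nat) := State {
  started : seq 'I_n;
  completed : seq 'I_n;
  durations : seq R;
  running : {set 'I_n};
  elapsed : {ffun 'I_n -> R} }.

(* A policy returns [None] exactly when no unstarted task remains; otherwise it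
   returns a task outside [started s]. *)
Record policy (R : realType) (n : nat) := Policy {
  next_task :> state R n -> option 'I_n;
  next_task_unstarted s i : next_task s = Some i -> i \notin started s;
  next_task_None s : next_task s = None -> forall i, i \in started s }.

Section ListPolicy.
Variables (R : realType) (n : nat) (pi : 'S_n).

Definition SL_next (s : state R n) : option 'I_n :=
  ohead [seq i <- [seq pi k | k <- enum 'I_n] | i \notin started s].

Lemma SL_next_unstarted s i : SL_next s = Some i -> i \notin started s.
Proof.
rewrite /SL_next; case E: [seq _ <- _ | _] => [//|a l] /= [<-].
by have := mem_head a l; rewrite -E mem_filter => /andP[].
Qed.

Lemma SL_next_None s : SL_next s = None -> forall i, i \in started s.
Proof.
rewrite /SL_next; case E: [seq _ <- _ | _] => [|//] _ i; apply/negPn/negP => ni.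
have : i \in [seq i <- [seq pi k | k <- enum 'I_n] | i \notin started s].
  rewrite mem_filter ni; apply/mapP; exists (pi^-1%g i); first by rewrite mem_enum.
  by rewrite permKV.
by rewrite E.
Qed.

Definition SL_policy : policy R n := Policy SL_next_unstarted SL_next_None.

End ListPolicy.

(* [tie_machine] selects among the machines that become idle earliest;
   [tie_task] orders the tasks that complete simultaneously. *)
Record tie_rule (n m : nat) := TieRule {
  tie_machine : {set 'I_m} -> 'I_m;
  tie_machineP A : A != finset.set0 -> tie_machine A \in A;
  tie_task : rel 'I_n;
  tie_task_total : total tie_task;
  tie_task_anti : antisymmetric tie_task;
  tie_task_trans : transitive tie_task }.

Section Run.
Variables (R : realType) (n m : nat) (tau : tie_rule n m).
Variables (P : policy R n) (d : 'rV[R]_n).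

(* What has happened up to and including some task start; [begun] gives the
   start times and is meaningful on [c_started] only. *)
Record config := Config {
  c_started : seq 'I_n;
  c_completed : seq 'I_n;
  alloc : allocation n m;
  begun : {ffun 'I_n -> R} }.

Definition init : config :=
  Config [::] [::] [ffun=> finset.set0] [ffun=> 0].

(* As long as some task is unstarted no machine has ever waited, so the time at
   which machine j becomes idle is the total duration of the tasks put on it. *)
Definition next_machine (c : config) : 'I_m :=
  tie_machine tau
    [set j | [forall k, load d (alloc c) j <= load d (alloc c) k]]%SET.

Definition next_time (c : config) : R := load d (alloc c) (next_machine c).

Definition completion (c : config) (i : 'I_n) : R := begun c i + d 0 i.

Definition completes_before (c : config) : rel 'I_n := fun i k =>
  (completion c i < completion c k) ||
  (completion c i == completion c k) && tie_task tau i k.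

(* All completions up to and including the current time are recorded before the
   policy is consulted, also those of tasks with duration 0. *)
Definition next_completed (c : config) : seq 'I_n :=
  c_completed c ++
  sort (completes_before c)
    [seq i <- c_started c |
      (i \notin c_completed c) && (completion c i <= next_time c)].

Definition observed (c : config) : state R n :=
  let F := next_completed c in
  let I := [set i in c_started c | i \notin F]%SET in
  State (c_started c) F [seq d 0 i | i <- F] I
    [ffun i => if i \in I then next_time c - begun c i else 0].

Definition step (c : config) : config :=
  if P (observed c) is Some i then
    let j := next_machine c in
    Config (rcons (c_started c) i) (next_completed c)
      [ffun k => if k == j then i |: alloc c k else alloc c k]%SET
      [ffun k => if k == i then next_time c else begun c k]
  else c.

Definition schedule : allocation n m := alloc (iter n step init).

End Run.

Local Open Scope classical_set_scope.
Local Open Scope ereal_scope.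

Definition box (R : realType) n (lo hi : 'rV[R]_n) : set 'rV[R]_n :=
  [set d | forall i, (lo 0 i <= d 0 i <= hi 0 i)%R].

Definition SA_worst (R : realType) n m (U : set 'rV[R]_n) (J : allocation n m) :
  \bar R := ereal_sup [set (makespan d J)%:E | d in U].

Definition worst (R : realType) n m (tau : tie_rule n m) (U : set 'rV[R]_n)
  (P : policy R n) : \bar R :=
  ereal_sup [set (makespan d (schedule tau P d))%:E | d in U].

Definition is_min (R : realType) (A : set (\bar R)) (v : \bar R) : Prop :=
  A v /\ lbound A v.

(* Main.v *)
Require Import Defs.
From mathcomp Require Import all_boot all_order all_algebra perm.
From mathcomp Require Import boolp classical_sets reals constructive_ereal ereal.

(** Let v be the least makespan of a partition of the tasks when every task i
lasts as long as possible, [hi 0 i].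

No policy beats v. The makespan of a partition increases with the durations, so
the worst case of a static allocation is [hi], and the optimal one has worst
case v. An adaptive policy, run on [hi], ends with some partition of the tasks
([schedule_alloc_of]), whose makespan is at least v.

Some list policy reaches v. Fix an optimal partition and the static schedule in
which each machine processes its tasks one after the other, with durations [hi].
List the tasks in the order of their starts in this static schedule. Then, for
every d in the box, list scheduling starts no task i later than the static
schedule does ([next_time_start]). Otherwise, when i is about to be started, the
m machines are all busy beyond [start i]; the last task on each of them precedes
i in the list, and, by induction, finishes in the static schedule no earlier
than in the run, hence after [start i]. So the static schedule would have to
process m + 1 different tasks at time [start i] on m machines ([machine_free]).
Every task thus completes by its static finish time, and these are at most v.

This order is also what makes the list policy immune to Graham's anomalies:
durations shorter than [hi] cannot delay any task beyond its static slot. *)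

Set Implicit Arguments.
Unset Strict Implicit.
Unset Printing Implicit Defensive.

Import Order.TTheory GRing.Theory Num.Theory.
Local Open Scope ring_scope.

(** * Partitions as assignments of tasks to machines *)

(** Assignments form a finite type, so that an optimal one exists; unlike
allocations, they are partitions by construction. *)
Definition alloc_of n m (mu : {ffun 'I_n -> 'I_m}) : allocation n m :=
  [ffun j => [set i | mu i == j]%SET].

Lemma alloc_of_partition n m (mu : {ffun 'I_n -> 'I_m}) :
  is_partition (alloc_of mu).
Proof.
split=> [j k jk|].
  rewrite -setI_eq0; apply/eqP/setP => i; rewrite !inE !ffunE !inE.
  by apply/negP => /andP[/eqP ij /eqP ik]; rewrite -ij ik eqxx in jk.
apply/setP => i; rewrite finset.in_setT; apply/bigcupP; exists (mu i) => //.
by rewrite ffunE inE.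
Qed.

Lemma is_partition_alloc_of n m (J : allocation n m) :
  is_partition J -> exists mu, J = alloc_of mu.
Proof.
move=> [dJ cJ].
have ex i : exists j, i \in J j.
  have : i \in (\bigcup_(j < m) J j)%SET by rewrite cJ finset.in_setT.
  by case/bigcupP => j _; exists j.
exists [ffun i => xchoose (ex i)]; apply/ffunP => j; apply/setP => i.
rewrite !ffunE inE ffunE; apply/idP/eqP => [iJ|<-]; last exact: (xchooseP (ex i)).
apply/eqP; apply: contraLR iJ => /dJ /disjointFr -> //.
exact: (xchooseP (ex i)).
Qed.

Lemma makespan_le (R : realType) n m (d e : 'rV[R]_n) (J : allocation n m) :
  (forall i, d 0 i <= e 0 i) -> makespan d J <= makespan e J.
Proof. by move=> de; apply: le_bigmax2 => j _; apply: ler_sum. Qed.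

Lemma ler_sum_subpred (R : numDomainType) (I : finType) (P Q : pred I)
    (F : I -> R) :
  (forall i, 0 <= F i) -> (forall i, P i -> Q i) ->
  \sum_(i | P i) F i <= \sum_(i | Q i) F i.
Proof.
move=> F0 PQ; rewrite !(big_mkcond _ F); apply: ler_sum => i _.
by case: ifP => [/PQ ->//|_]; case: ifP.
Qed.

(** * The static schedule of an assignment *)

Section StaticSchedule.
Variables (R : realType) (n m : nat) (hi : 'rV[R]_n).
Hypothesis hi0 : forall i, 0 <= hi 0 i.
Variable mu : {ffun 'I_n -> 'I_m}.

(** Each machine processes its tasks in increasing order of index; any fixed
order would give the same makespan. *)
Definition start (i : 'I_n) : R :=
  \sum_(k | (mu k == mu i) && (k < i)%N) hi 0 k.

Definition finish (i : 'I_n) : R := start i + hi 0 i.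

Lemma start_ge0 i : 0 <= start i. Proof. exact: sumr_ge0. Qed.

Lemma finish_start x y : mu x = mu y -> (x < y)%N -> finish x <= start y.
Proof.
move=> mxy xy; rewrite /finish /start [leRHS](bigD1 x) ?mxy ?eqxx//=.
rewrite [leLHS]addrC lerD2l; apply: ler_sum_subpred => // k /andP[/eqP -> kx].
by rewrite eqxx (ltn_trans kx xy) -val_eqE /= neq_ltn kx.
Qed.

Lemma finish_makespan i : finish i <= makespan hi (alloc_of mu).
Proof.
apply: le_trans (le_bigmax _ _ (mu i)); rewrite /load ffunE.
rewrite (bigD1 i) ?inE //= /finish [leLHS]addrC lerD2l.
apply: ler_sum_subpred => // k /andP[/eqP mk ki].
by rewrite inE mk eqxx -val_eqE /= neq_ltn ki.
Qed.

(** The index breaks ties in accordance with the order on each machine: a task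
of duration 0 starts together with its successor, and has to precede it. *)
Definition precedes : rel 'I_n := fun x y =>
  (start x < start y) || (start x == start y) && (x <= y)%N.

Lemma precedes_total : total precedes.
Proof. by move=> x y; rewrite /precedes; case: ltgtP => //= _; apply: leq_total. Qed.

Lemma precedes_trans : transitive precedes.
Proof.
move=> y x z /orP[xy|/andP[/eqP xy lxy]] /orP[yz|/andP[/eqP yz lyz]];
  rewrite /precedes.
- by rewrite (lt_trans xy yz).
- by rewrite -yz xy.
- by rewrite xy yz.
- by rewrite xy yz eqxx (leq_trans lxy lyz) orbT.
Qed.

Lemma precedes_start x y : precedes x y -> start x <= start y.
Proof. by case/orP => [/ltW //|/andP[/eqP ->]]. Qed.

(** If x came after i on their common machine, then x would start no earlier
than i; as x precedes i, they would start together, and the index would put i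
first. *)
Lemma start_after_finish x i :
  mu x = mu i -> x != i -> precedes x i -> finish x <= start i.
Proof.
move=> mxi; rewrite -val_eqE /= neq_ltn => /orP[/(finish_start mxi) //|ix] xi.
have six : start i <= start x.
  by apply: le_trans (finish_start (esym mxi) ix); rewrite lerDl.
by move: xi; rewrite /precedes ltNge six /= leqNgt ix andbF.
Qed.

(** If the m tasks [w j] were all unfinished at time [start i], they would be in
process at that time, hence on different machines; one of them would then share
the machine of i, and a task that precedes i there is finished when i starts. *)
Lemma machine_free (w : 'I_m -> 'I_n) i : injective w ->
  (forall j, w j != i) -> (forall j, precedes (w j) i) ->
  exists j, finish (w j) <= start i.
Proof.
move=> winj wi pwi; apply/existsP; apply: contraT; rewrite negb_exists.
move=> /forallP busy.
have muw_inj : injective (mu \o w).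
  move=> j k /= mjk; apply: winj; apply/eqP; apply: contraT.
  have clash x y : mu (w x) = mu (w y) -> (w x < w y)%N -> false.
    move=> mxy /(finish_start mxy) fs; apply: contraT => _.
    by have := busy x; rewrite (le_trans fs (precedes_start (pwi y))).
  by rewrite -val_eqE /= neq_ltn => /orP[/(clash _ _ mjk)|/(clash _ _ (esym mjk))].
(* An injective map from the machines to themselves also hits [mu i]. *)
have [g _ gK] := injF_bij muw_inj.
by have := busy (g (mu i)); rewrite start_after_finish //; exact: gK.
Qed.

End StaticSchedule.

(** * Lists sorted by a relation *)

Lemma exists_perm_sort n (r : rel 'I_n) :
  exists pi : 'S_n, [seq pi k | k <- enum 'I_n] = sort r (enum 'I_n).
Proof.
have : perm_eq (sort r (enum 'I_n)) (ord_tuple n) by rewrite perm_sort val_ord_tuple.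
case/tuple_permP => pi ->; exists pi.
by rewrite -val_ord_tuple /=; apply: eq_map => k; rewrite tnth_ord_tuple.
Qed.

Lemma SL_next_min (R : realType) n (pi : 'S_n) (r : rel 'I_n) (s : state R n) i :
  total r -> transitive r ->
  [seq pi k | k <- enum 'I_n] = sort r (enum 'I_n) ->
  SL_next pi s = Some i -> forall y, y \notin started s -> r i y.
Proof.
move=> rtot rtr lE; rewrite /SL_next lE.
set l := [seq _ <- _ | _] => li y ny.
have yl : y \in l by rewrite mem_filter ny mem_sort mem_enum.
have : sorted r l by apply: sorted_filter => //; exact: sort_sorted.
case: l li yl => //= a l [->]; rewrite inE => /orP[/eqP ->|yl] pl.
  by have := rtot i i; rewrite orbb.
by have /allP := order_path_min rtr pl; apply.
Qed.

(** * Runs of an arbitrary policy *)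

Section Run.
Variables (R : realType) (n m : nat) (tau : tie_rule n m).
Variables (P : policy R n) (d : 'rV[R]_n).

(** The allocation of a reachable configuration is the restriction of an
assignment to the started tasks: this says at once that the machines hold
disjoint sets and that these sets cover the started tasks. *)
Definition assigns (c : config R n m) (mu : 'I_n -> 'I_m) : Prop :=
  forall i j, (i \in alloc c j) = (i \in c_started c) && (mu i == j).

Lemma step_cases (c : config R n m) :
  (step tau P d c = c /\ forall i, i \in c_started c) \/
  exists i, [/\ P (observed tau d c) = Some i, i \notin c_started c,
    c_started (step tau P d c) = rcons (c_started c) i &
    alloc (step tau P d c) = [ffun k => if k == next_machine tau d c
                                        then i |: alloc c k else alloc c k]%SET].
Proof.
rewrite /step; case E: (P _) => [i|].
  by right; exists i; split => //; exact: (next_task_unstarted E).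
by left; split => //; exact: (next_task_None E).
Qed.

Lemma assigns_step (c : config R n m) mu : assigns c mu ->
  exists nu, assigns (step tau P d c) nu.
Proof.
move=> cmu; case: (step_cases c) => [[-> _]|[i [_ ni sE aE]]]; first by exists mu.
exists (fun k => if k == i then next_machine tau d c else mu k) => k j.
rewrite sE aE ffunE mem_rcons inE.
case: (eqVneq j (next_machine tau d c)) => [->|jn].
  by rewrite !inE cmu; case: (eqVneq k i) => //= _; rewrite eqxx.
rewrite cmu; case: (eqVneq k i) => [->|//]; rewrite (negPf ni) /=.
by rewrite eq_sym (negPf jn).
Qed.

Lemma assigns_run k : (0 < m)%N ->
  exists mu, assigns (iter k (step tau P d) (init R n m)) mu.
Proof.
move=> m0; elim: k => [|k [mu /assigns_step //]].
by exists (fun=> Ordinal m0) => i j; rewrite ffunE !inE.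
Qed.

(** Each step starts a new task unless none is left, so that n steps start all
tasks. *)
Lemma size_started k : let c := iter k (step tau P d) (init R n m) in
  uniq (c_started c) /\
  (size (c_started c) = k \/ forall i, i \in c_started c).
Proof.
elim: k => [|k]; first by split => //; left.
set c := iter k _ _; rewrite iterS -/c /= => -[uc sc].
case: (step_cases c) => [[-> all]|[i [_ ni sE _]]]; first by split => //; right.
rewrite sE rcons_uniq ni uc size_rcons; split => //; left.
by case: sc => [->|all] //; rewrite all in ni.
Qed.

Lemma schedule_alloc_of : (0 < m)%N ->
  exists mu, schedule tau P d = alloc_of mu.
Proof.
move=> m0; have [mu cmu] := assigns_run n m0; have [uc sc] := size_started n.
have all i : i \in c_started (iter n (step tau P d) (init R n m)).
  case: sc => [sc|//].
  have sub : (c_started (iter n (step tau P d) (init R n m)) \subset 'I_n).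
    exact/subset_predT.
  have /subset_cardP/(_ sub) -> //: #|c_started (iter n (step tau P d) (init R n m))| = #|'I_n|.
  by rewrite (card_uniqP uc) sc card_ord.
exists [ffun i => mu i]; apply/ffunP => j; apply/setP => i.
by rewrite cmu all ffunE inE ffunE.
Qed.

Lemma next_machine_min (c : config R n m) j : (0 < m)%N ->
  load d (alloc c) (next_machine tau d c) <= load d (alloc c) j.
Proof.
move=> m0; rewrite /next_machine; set A := [set _ | _]%SET.
suff : A != finset.set0 by move/(tie_machineP tau); rewrite inE => /forallP.
apply/set0Pn.
have [j0 _ j0min] := @Order.TotalTheory.arg_minP _ R _ (Ordinal m0) xpredT
  (load d (alloc c)) isT.
by exists j0; rewrite inE; apply/forallP => k; apply: j0min.
Qed.

End Run.

(** * The run of the list policy compared with the static schedule *)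

Section ListRun.
Variables (R : realType) (n m : nat) (tau : tie_rule n m) (hi : 'rV[R]_n).
Hypothesis hi0 : forall i, 0 <= hi 0 i.
Variables (mu : {ffun 'I_n -> 'I_m}) (pi : 'S_n) (d : 'rV[R]_n).
Hypothesis pi_sorted :
  [seq pi k | k <- enum 'I_n] = sort (precedes hi mu) (enum 'I_n).
Hypothesis d_hi : forall i, d 0 i <= hi 0 i.

Let run k := iter k (step tau (SL_policy R pi) d) (init R n m).

(** Tasks are started in the order of the list, so the started ones form an
initial segment for [precedes]. *)
Lemma started_precedes k x y : x \in c_started (run k) ->
  y \notin c_started (run k) -> precedes hi mu x y.
Proof.
elim: k x y => [//|k IH] x y; rewrite /run iterS -/(run k).
have [[-> _]|[i [Pi ni -> _]]] := step_cases tau (SL_policy R pi) d (run k).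
  exact: IH.
rewrite !mem_rcons !inE negb_or => /orP[/eqP ->|xk] /andP[_ yk]; last exact: IH.
exact: (SL_next_min (@precedes_total _ _ _ hi mu) (@precedes_trans _ _ _ hi mu)
  pi_sorted Pi yk).
Qed.

(** In a run, the witness x is the last task put on machine j, which completes
at the time [load d (alloc c) j]. The first case covers the machines without a task; they
are idle at time 0, before any static start. *)
Definition dominated (c : config R n m) j : Prop :=
  load d (alloc c) j <= 0 \/
  exists2 x, x \in alloc c j & load d (alloc c) j <= finish hi mu x.

(** Were all machines busy beyond [start i], the witnesses of domination would
be m different tasks that precede i and are unfinished at [start i] in the
static schedule, against [machine_free]. *)
Lemma next_time_start k i : (0 < m)%N -> (forall j, dominated (run k) j) ->
  i \notin c_started (run k) ->
  (forall x, x \in c_started (run k) -> precedes hi mu x i) ->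
  next_time tau d (run k) <= start hi mu i.
Proof.
move=> m0 dom ni pre; rewrite /next_time leNgt; apply/negP => lt_next.
have late j : start hi mu i < load d (alloc (run k)) j.
  exact: lt_le_trans lt_next (next_machine_min _ _ _ _ m0).
have ex j : exists x, (x \in alloc (run k) j) &&
    (load d (alloc (run k)) j <= finish hi mu x).
  have [l0|[x xj lx]] := dom j; last by exists x; rewrite xj.
  by have := lt_le_trans (late j) l0; rewrite ltNge start_ge0.
have [nu cnu] := assigns_run tau (SL_policy R pi) d k m0.
pose w j := xchoose (ex j).
have wP j : [/\ nu (w j) = j, w j \in c_started (run k) &
    load d (alloc (run k)) j <= finish hi mu (w j)].
  by have /andP[] := xchooseP (ex j); rewrite cnu => /andP[? /eqP].
have winj : injective w.
  by move=> j1 j2 e; have [<- _ _] := wP j1; have [<- _ _] := wP j2; rewrite e.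
have wi j : w j != i by have [_ + _] := wP j; apply: contraTneq => ->.
have wpre j : precedes hi mu (w j) i by have [_ + _] := wP j; apply: pre.
have [j fj] := machine_free hi0 winj wi wpre.
by have [_ _ lj] := wP j; have := late j; rewrite ltNge (le_trans lj fj).
Qed.

(** The task i just started begins by [start i] and lasts at most [hi 0 i], so
it is the new witness on its machine. *)
Lemma dominated_run k j : (0 < m)%N -> dominated (run k) j.
Proof.
move=> m0; elim: k j => [|k IH] j.
  by left; rewrite /load ffunE big_set0.
have [[cE _]|[i [Pi ni _ aE]]] := step_cases tau (SL_policy R pi) d (run k).
  by rewrite /run iterS cE; apply: IH.
have := @next_time_start k i m0 IH ni (fun x xk => started_precedes xk ni).
rewrite /next_time /dominated /run iterS -/(run k) /load aE ffunE.
have [nu cnu] := assigns_run tau (SL_policy R pi) d k m0.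
case: eqVneq => [-> si|_ _]; last exact: IH.
right; exists i; first by rewrite setU11.
rewrite big_setU1 ?cnu ?(negPf ni) //= addrC.
exact: lerD.
Qed.

Lemma makespan_SL : (0 < m)%N ->
  makespan d (schedule tau (SL_policy R pi) d) <= makespan hi (alloc_of mu).
Proof.
move=> m0; have mk0 : 0 <= makespan hi (alloc_of mu) by apply: bigmax_ge_id.
apply: bigmax_le => // j _.
have [l0|[x _ lx]] := dominated_run n j m0; first exact: le_trans l0 mk0.
exact: le_trans lx (finish_makespan hi0 mu x).
Qed.

End ListRun.

Local Open Scope classical_set_scope.

Theorem proposition1 (R : realType) (n m : nat) (hm : (1 <= m)%N)
  (hmn : (m <= n)%N) (tau : tie_rule n m) (lo hi : 'rV[R]_n)
  (hlo : forall i, 0 <= lo 0 i) (hhi : forall i, lo 0 i <= hi 0 i) :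
  exists v : R,
    [/\ is_min [set SA_worst (box lo hi) J
                 | J in [set J : allocation n m | is_partition J]] v%:E,
        is_min [set worst tau (box lo hi) (SL_policy R pi)
                 | pi in [set: 'S_n]] v%:E
      & is_min [set worst tau (box lo hi) P
                 | P in [set: policy R n]] v%:E].
Proof.
have hi0 i : 0 <= hi 0 i by exact: le_trans (hlo i) (hhi i).
have hi_box : box lo hi hi by move=> i; rewrite hhi lexx.
have box_le d : box lo hi d -> forall i, d 0 i <= hi 0 i.
  by move=> dU i; have /andP[] := dU i.
pose mu0 : {ffun 'I_n -> 'I_m} := [ffun=> Ordinal hm].
have [mu _ mu_min] := @Order.TotalTheory.arg_minP _ R _ mu0 xpredT
  (fun mu => makespan hi (alloc_of mu)) isT.
have [pi pi_sorted] := exists_perm_sort (precedes hi mu).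
pose v := makespan hi (alloc_of mu).
have SAE (J : allocation n m) : SA_worst (box lo hi) J = (makespan hi J)%:E.
  apply/eqP; rewrite eq_le; apply/andP; split.
    by apply: ge_ereal_sup => _ [d /box_le dU <-]; rewrite lee_fin makespan_le.
  by apply: ereal_sup_ubound; exists hi.
have lower (P : policy R n) : (v%:E <= worst tau (box lo hi) P)%E.
  have [nu nuE] := schedule_alloc_of tau P hi hm.
  apply: (@le_trans _ _ (makespan hi (schedule tau P hi))%:E).
    by rewrite nuE lee_fin mu_min.
  by apply: ereal_sup_ubound; exists hi.
have SLE : worst tau (box lo hi) (SL_policy R pi) = v%:E.
  apply/eqP; rewrite eq_le lower andbT.
  apply: ge_ereal_sup => _ [d /box_le dU <-]; rewrite lee_fin.
  exact: makespan_SL.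
exists v; split; split.
- by exists (alloc_of mu); [exact: alloc_of_partition | exact: SAE].
- move=> _ [J /is_partition_alloc_of[nu ->] <-].
  by rewrite SAE lee_fin mu_min.
- by exists pi.
- by move=> _ [rho _ <-].
- by exists (SL_policy R pi).
- by move=> _ [P _ <-].
Qed.
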